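(* Let $\Omega$ be a measurable space with reference measure $\mathrm{d}\mathbf{y}$, let $q$ be a probability density on $\Omega$, and let $f_{\bm{\theta}}:\Omega\to\mathbb{R}$ for $\bm{\theta}\in\Theta$. Fix $\bm{\theta}\in\Theta$, $\nu\in\mathbb{R}$ and data $\mathcal{S}=\{\mathbf{y}_1,\ldots,\mathbf{y}_n\}\subset\Omega$, and assume $f_{\bm{\theta}}(\mathbf{y})-\log q(\mathbf{y})\le C(\bm{\theta})$ for all $\mathbf{y}\in\Omega$, for some constant $C(\bm{\theta})$. Let $\bm{r}_1,\bm{r}_2,\ldots$ be IID with density $q$, and define $$\mathcal{R}^m(\bm{\theta},\nu)=\sum_{i=1}^n\log\left[\frac{n\exp\{f_{\bm{\theta}}(\mathbf{y}_i)+\nu\}}{n\exp\{f_{\bm{\theta}}(\mathbf{y}_i)+\nu\}+mq(\mathbf{y}_i)}\right]+\sum_{j=1}^m\log\left[\frac{mq(\bm{r}_j)}{n\exp\{f_{\bm{\theta}}(\bm{r}_j)+\nu\}+mq(\bm{r}_j)}\right],$$ $$\mathcal{M}(\bm{\theta},\nu)=\sum_{i=1}^n\{f_{\bm{\theta}}(\mathbf{y}_i)+\nu\}-n\int_\Omega\exp\{f_{\bm{\theta}}(\mathbf{y})+\nu\}\,\mathrm{d}\mathbf{y}.$$ Then $$\mathcal{R}^m(\bm{\theta},\nu)+n\log(m/n)+\sum_{i=1}^n\log q(\mathbf{y}_i)\to\mathcal{M}(\bm{\theta},\nu)$$ almost surely as $m\to+\infty$, with respect to the randomness of the reference points $\b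m{r}_1,\ldots,\bm{r}_m$.
   Context: $\mathcal{R}^m$ is the log-likelihood of the logistic regression (noise-contrastive divergence) that classifies the data points (label 1) against the $m$ reference points (label 0) with log-odds $f_{\bm{\theta}}(\mathbf{u})+\nu-\log q(\mathbf{u})+\log(n/m)$. *)

(* Defs.v *)
From HB Require Import structures.
From mathcomp Require Import all_boot all_order all_algebra.
From mathcomp Require Import all_classical all_reals all_analysis.
Set Implicit Arguments. Unset Strict Implicit. Unset Printing Implicit Defensive.
Import Order.TTheory GRing.Theory Num.Theory.
Import numFieldNormedType.Exports.
Local Open Scope classical_set_scope.
Local Open Scope ring_scope.

Definition mutually_independent (d d' : measure_display) (T : measurableType d)
  (R : realType) (P : probability T R) (U : measurableType d')
  (X : nat -> T -> U) : Prop :=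
  forall (J : seq nat) (A : nat -> set U), uniq J ->
    (forall j, j \in J -> measurable (A j)) ->
    P (\bigcap_(j in [set` J]) (X j @^-1` A j)) =
    (\prod_(j <- J) P (X j @^-1` A j))%E.

Definition has_density (d d' : measure_display) (T : measurableType d)
  (R : realType) (P : probability T R) (U : measurableType d')
  (mu : {measure set U -> \bar R}) (q : U -> R) (X : T -> U) : Prop :=
  forall A : set U, measurable A ->
    (P (X @^-1` A) = \int[mu]_(x in A) (q x)%:E)%E.

Definition Rm (U : Type) (R : realType) (n m : nat) (y : 'I_n -> U)
  (ft : U -> R) (q : U -> R) (nu : R) (r : nat -> U) : R :=
  \sum_(i < n) ln ((n%:R * expR (ft (y i) + nu)) /
                   (n%:R * expR (ft (y i) + nu) + m%:R * q (y i)))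
  + \sum_(j < m) ln ((m%:R * q (r j)) /
                   (n%:R * expR (ft (r j) + nu) + m%:R * q (r j))).

Definition Mobj (d' : measure_display) (U : measurableType d') (R : realType)
  (mu : {measure set U -> \bar R}) (n : nat) (y : 'I_n -> U)
  (ft : U -> R) (nu : R) : R :=
  \sum_(i < n) (ft (y i) + nu)
  - n%:R * Rintegral mu setT (fun x => expR (ft x + nu)).

(* Main.v *)
(** With [g = exp (f + nu) / q], which lies in [[0, exp (C + nu)]], the second sum
of [Rm] is [- sum_(j < m) ln (1 + n g(r_j) / m)].  Since [x - x^2 <= ln (1 + x) <= x]
for [x >= 0], it differs from [- n] times the empirical mean of [g(r_j)] by [O(1/m)],
and that mean tends almost surely to [E g(r_1) = int exp (f + nu)] by the strong law
of large numbers.  The strong law for bounded pairwise uncorrelated variables comes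
from the summability of the second moments of the means along the squares. *)
Require Import Defs.
From HB Require Import structures.
From mathcomp Require Import all_boot all_order all_algebra.
From mathcomp Require Import all_classical all_reals all_analysis.
From mathcomp Require Import measurable_realfun zify ring lra.
Import Order.TTheory GRing.Theory Num.Theory.
Import numFieldNormedType.Exports.
Local Open Scope classical_set_scope.
Local Open Scope ring_scope.

(** * Integration against a measure given by a density *)

Section density.
Context d (T : measurableType d) (R : realType).
Variables (mu nu : {measure set T -> \bar R}) (q : T -> R).
Hypotheses (mq : measurable_fun setT q) (q0 : forall x, 0 <= q x).
Hypothesis nuE : forall A, measurable A ->
  nu A = (\int[mu]_(x in A) (q x)%:E)%E.
Local Open Scope ereal_scope.
Import HBNNSimple.

Let mqE : measurable_fun setT (fun x => (q x)%:E).
Proof. exact/measurable_EFinP. Qed.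

(** A simple function is a finite combination of indicators of its level sets; on each of these the
    claim is [nuE], and both integrals are additive. *)
Lemma integral_density_nnsfun (h : {nnsfun T >-> R}) :
  \int[nu]_x (h x)%:E = \int[mu]_x ((h x)%:E * (q x)%:E).
Proof.
rewrite integralT_nnsfun sintegralE.
transitivity (\int[mu]_x (\sum_(y \in range h)
    (y%:E * ((q x)%:E * (\1_(h @^-1` [set y]) x)%:E)))); last first.
  apply: eq_integral => x _; rewrite fimfunE -fsumEFin//.
  rewrite ge0_mule_fsuml; last by move=> i; exact: nnfun_muleindic_ge0.
  by apply: eq_fsbigr => y _; rewrite EFinM -muleA [X in _ * X]muleC.
have m1 y : measurable_fun setT
    (fun x => (q x)%:E * (\1_(h @^-1` [set y]) x)%:E).
  by apply: emeasurable_funM => //; exact/measurable_EFinP.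
rewrite ge0_integral_fsum//; last 2 first.
- by move=> y; exact: measurable_funeM.
- move=> y x _; rewrite muleCA mule_ge0 ?lee_fin//.
  exact: nnfun_muleindic_ge0.
apply: eq_fsbigr => y /[!inE] -[x _ <-].
rewrite ge0_integralZl//; last 2 first.
- by move=> z _; rewrite mule_ge0// lee_fin.
- by rewrite lee_fin.
by rewrite nuE// integral_mkcond epatch_indic.
Qed.

(** Monotone convergence along simple approximations of [g], applied on both sides; [q0] keeps the
    products with [q] nondecreasing. *)
Lemma ge0_integral_density (g : T -> \bar R) :
  measurable_fun setT g -> (forall x, 0 <= g x) ->
  \int[nu]_x g x = \int[mu]_x (g x * (q x)%:E).
Proof.
move=> mg g0; pose h := nnsfun_approx measurableT mg.
have hg x : (h n x)%:E @[n --> \oo] --> g x by exact: cvg_nnsfun_approx.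
have ndh x : {homo (fun n => (h n x)%:E) : a b / (a <= b)%N >-> a <= b}.
  by move=> a b ab; rewrite lee_fin; exact/lefP/nd_nnsfun_approx.
transitivity (limn (fun n => \int[nu]_x (h n x)%:E)).
  rewrite -monotone_convergence//.
  - by apply: eq_integral => x _; exact/esym/cvg_lim.
  - by move=> n; exact/measurable_EFinP.
  - by move=> n x _; rewrite lee_fin.
under eq_fun do rewrite integral_density_nnsfun.
rewrite -monotone_convergence//.
- apply: eq_integral => x _; apply: cvg_lim => //; exact: cvgeZr.
- by move=> n; apply: emeasurable_funM => //; exact/measurable_EFinP.
- by move=> n x _; rewrite mule_ge0// lee_fin.
- by move=> x _ a b ab; rewrite lee_wpmul2r ?lee_fin//; exact: ndh.
Qed.

End density.

(** * Independence and products of integrals *)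

Section independence.
Context d d' (T : measurableType d) (U : measurableType d') (R : realType).
Variables (P : probability T R) (X Y : {mfun T >-> U}).
Local Open Scope ereal_scope.

(** Independence makes the law of the pair agree with the product law on rectangles, hence
    everywhere by uniqueness of the product measure. Tonelli then separates the two factors. *)
Lemma ge0_integral_independent (g h : U -> \bar R) :
  (forall A B, measurable A -> measurable B ->
    P (X @^-1` A `&` Y @^-1` B) = P (X @^-1` A) * P (Y @^-1` B)) ->
  measurable_fun setT g -> measurable_fun setT h ->
  (forall x, 0 <= g x) -> (forall x, 0 <= h x) ->
  \int[P]_w (g (X w) * h (Y w)) = (\int[P]_w g (X w)) * (\int[P]_w h (Y w)).
Proof.
move=> XY mg mh g0 h0.
have mXY : measurable_fun setT (fun w => (X w, Y w)).
  exact/measurable_fun_pair.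
pose Z : {mfun T >-> (U * U)%type} :=
  HB.pack (fun w => (X w, Y w)) (isMeasurableFun.Build _ _ _ _ _ mXY).
pose gh z := g z.1 * h z.2.
have mgh : measurable_fun [set: U * U] gh.
  by apply: emeasurable_funM; exact: measurableT_comp.
have gh0 z : 0 <= gh z by rewrite mule_ge0.
transitivity (\int[distribution P Z]_z gh z).
  by rewrite ge0_integral_distribution.
transitivity (\int[(distribution P X \x distribution P Y)%E]_z gh z).
  apply: eq_measure_integral => A mA _; apply/esym.
  by apply: product_measure_unique => // B C mB mC; exact: XY.
rewrite fubini_tonelli1// /fubini_F /gh/=.
under eq_integral do rewrite ge0_integralZl//.
rewrite ge0_integralZr//; last exact: integral_ge0.
by rewrite !ge0_integral_distribution.
Qed.

End independence.

(** * Deterministic estimates for averages and logarithms *)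

Lemma floor_sqrt (m : nat) : exists k : nat, (k ^ 2 <= m < k.+1 ^ 2)%N.
Proof.
have h0 : exists k : nat, (k ^ 2 <= m)%N by exists 0%N.
have hb k : (k ^ 2 <= m)%N -> (k <= m)%N.
  by apply: leq_trans; rewrite -mulnn; case: k => // k; exact: leq_pmulr.
exists (ex_maxn h0 hb); case: ex_maxnP => k -> kmax /=.
by rewrite ltnNge; apply/negP => /kmax; rewrite ltnn.
Qed.

Lemma le_norm_sum_nat (R : numDomainType) (z : nat -> R) (B : R) (a b : nat) :
  (forall j, `|z j| <= B) -> `|\sum_(a <= j < b) z j| <= B *+ (b - a).
Proof.
move=> zB; apply: le_trans (ler_norm_sum _ _ _) _.
by apply: le_trans (ler_sum _ (fun j _ => zB j)) _; rewrite sumr_const_nat.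
Qed.

(* Between the squares k^2 <= m < (k+1)^2 the partial sum moves by
   O(k B), which is o(m). *)
Lemma cvg_mean_squares (R : realType) (z : nat -> R) (B : R) :
  (forall j, `|z j| <= B) ->
  (\sum_(0 <= j < k.+1 ^ 2) z j) / (k.+1 ^ 2)%:R @[k --> \oo] --> (0 : R) ->
  (\sum_(0 <= j < m) z j) / m%:R @[m --> \oo] --> (0 : R).
Proof.
move=> zB hsq; have B0 : 0 <= B := le_trans (normr_ge0 _) (zB 0%N).
apply/cvgr0Pnorm_le => e e0.
have e2 : 0 < e / 2 by rewrite divr_gt0.
have /cvgr0Pnorm_le /(_ _ e2) [N _ hN] := hsq.
(* Any [k >= K] satisfies [N <= k.-1], where [hN] controls the sum up to [k ^ 2], and
   [3 * B <= e / 2 * k], which absorbs the at most [2 * k] remaining terms into [e / 2 * k ^ 2]. *)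
pose K := (N + Num.truncn (3 * B / (e / 2))).+2.
exists (K ^ 2)%N => // m /= Km.
have [k /andP[km mk]] := floor_sqrt m.
have Kk : (K <= k)%N.
  by rewrite -ltnS -(ltn_sqr K k.+1) (leq_ltn_trans Km).
have k0 : (0 < k)%N by apply: leq_trans Kk.
have m0 : (0 < m)%N by apply: leq_trans km; rewrite expn_gt0 k0.
have m0R : 0 < m%:R :> R by rewrite ltr0n.
rewrite normrM [X in _ * X]ger0_norm ?invr_ge0 ?ler0n// ler_pdivrMr//.
rewrite (big_cat_nat (leq0n _) km)//=; apply: le_trans (ler_normD _ _) _.
have h1 : `|\sum_(0 <= j < k ^ 2) z j| <= e / 2 * m%:R.
  have := hN k.-1; rewrite prednK//= => /(_ _); rewrite normrM.
  rewrite [X in _ * X]ger0_norm ?invr_ge0 ?ler0n//.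
  rewrite ler_pdivrMr ?ltr0n ?expn_gt0 ?k0//.
  move=> h; apply: le_trans (h _) _.
    rewrite -ltnS prednK//; apply: leq_trans Kk.
    by rewrite /K ltnS ltnW// ltnS leq_addr.
  by rewrite ler_wpM2l ?ler_nat// ltW.
have h2 : `|\sum_(k ^ 2 <= j < m) z j| <= e / 2 * m%:R.
  apply: le_trans (le_norm_sum_nat _ _ _ _ _ zB) _.
  have le3k : (m - k ^ 2 <= 3 * k)%N.
    by move: mk; rewrite -!mulnn; lia.
  apply: (@le_trans _ _ (3 * B * k%:R)).
    by rewrite -[leLHS]mulr_natl [leRHS]mulrAC -natrM ler_wpM2r// ler_nat.
  have h3 : 3 * B <= e / 2 * k%:R.
    rewrite -ler_pdivrMl// mulrC ltW// (lt_le_trans (truncnS_gt _))//.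
    rewrite ler_nat (leq_trans _ Kk)// /K ltnS.
    by rewrite (leq_trans _ (leqnSn _))// leq_addl.
  apply: (@le_trans _ _ (e / 2 * k%:R * k%:R)); first by rewrite ler_wpM2r.
  by rewrite -mulrA -natrM mulnn ler_wpM2l ?ler_nat// ltW.
by rewrite [leRHS](_ : _ = e / 2 * m%:R + e / 2 * m%:R) ?lerD// -mulrDl -splitr.
Qed.

(** The bound [ln (1 + t) <= t] at [t = - x / (1 + x)] gives [x / (1 + x) <= ln (1 + x)], and
    [(x - x^2) (1 + x) = x - x^3 <= x]. *)
Lemma sub_sqr_le_ln1Dx (R : realType) (x : R) :
  0 <= x -> x - x ^+ 2 <= ln (1 + x).
Proof.
move=> x0; have x1 : 0 < 1 + x by lra.
rewrite -[leRHS]opprK -lnV ?posrE// lerNr.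
have -> : (1 + x)^-1 = 1 + (- (x / (1 + x))) by field; lra.
apply: le_trans (le_ln1Dx _) _.
  by rewrite ltrN2 ltr_pdivrMr//; lra.
rewrite lerN2 ler_pdivlMr//.
have : 0 <= x ^+ 3 by rewrite exprn_ge0.
nra.
Qed.

(** * The strong law for bounded uncorrelated variables *)

Section strong_law.
Context d (S : measurableType d) (R : realType) (P : probability S R).

Lemma probability_bounded_integrable (X : S -> R) (B : R) :
  measurable_fun setT X -> (forall w, `|X w| <= B) ->
  P.-integrable setT (fun w => (X w)%:E).
Proof.
move=> mX XB; apply: measurable_bounded_integrable => //.
  by rewrite ltey_eq fin_num_measure.
exists B; split; first exact: num_real.
by move=> M BM w _; exact: le_trans (XB w) (ltW BM).
Qed.

Variables (Z : nat -> S -> R) (B : R).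
Hypothesis mZ : forall j, measurable_fun setT (Z j).
Hypothesis ZB : forall j w, `|Z j w| <= B.
Hypothesis Z_uncorrelated : forall i j, i != j ->
  (\int[P]_w (Z i w * Z j w)%:E = 0)%E.

Let measurable_sumZ m : measurable_fun setT (fun w => \sum_(0 <= j < m) Z j w).
Proof. exact: measurable_sum. Qed.

(** Once the square is expanded, only the [m] diagonal terms survive, each at most [B ^ 2]. *)
Lemma integral_sqr_sum_le m :
  (\int[P]_w ((\sum_(0 <= j < m) Z j w) ^+ 2)%:E <= (B ^+ 2 *+ m)%:E)%E.
Proof.
have iZ i j : P.-integrable setT (fun w => (Z i w * Z j w)%:E).
  apply: (@probability_bounded_integrable _ (B * B)).
    exact: measurable_funM.
  by move=> w; rewrite normrM ler_pM.
under eq_integral => w _.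
  rewrite expr2 big_distrlr/= -sumEFin.
  under eq_bigr do rewrite -sumEFin.
  over.
rewrite integral_sum//; last by move=> i; exact: integrable_sum.
rewrite (@eq_big_nat _ _ _ _ _ _
  (fun i => \int[P]_w (Z i w * Z i w)%:E)%E); last first.
  move=> i /andP[_ im]; rewrite integral_sum//.
  rewrite (bigD1_seq i) ?mem_index_iota ?iota_uniq//= big1 ?adde0// => j ji.
  by rewrite Z_uncorrelated// eq_sym.
apply: (@le_trans _ _ (\sum_(0 <= i < m) (B ^+ 2)%:E)%E); last first.
  by rewrite sumEFin sumr_const_nat subn0.
apply: lee_sum => i _.
apply: (@le_trans _ _ (\int[P]_w (cst (B ^+ 2)%:E w))%E); last first.
  by rewrite -[leRHS]mule1 -(probability_setT P) integral_cst.
apply: ge0_le_integral => //.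
- by move=> w _; rewrite lee_fin -expr2 sqr_ge0.
- by apply/measurable_EFinP; exact: measurable_funM.
- move=> w _; rewrite lee_fin -expr2 -real_normK ?num_real//.
  by rewrite lerXn2r ?nnegrE// (le_trans _ (ZB i w)).
Qed.

Lemma strong_law_uncorrelated :
  {ae P, forall w, (\sum_(0 <= j < m) Z j w) / m%:R @[m --> \oo] --> (0 : R)}.
Proof.
pose V k w : R := ((\sum_(0 <= j < k.+1 ^ 2) Z j w) / (k.+1 ^ 2)%:R) ^+ 2.
have V0 k w : 0 <= V k w by rewrite sqr_ge0.
have mV k : measurable_fun setT (fun w => (V k w)%:E).
  apply/measurable_EFinP; apply: measurable_funX.
  by apply: measurable_funM => //; exact: measurable_sumZ.
have intV k : (\int[P]_w (V k w)%:E <= (B ^+ 2 / (k.+1 ^ 2)%:R)%:E)%E.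
  under eq_integral do rewrite /V exprMn mulrC EFinM.
  rewrite ge0_integralZl//; last 2 first.
  - by apply/measurable_EFinP; apply: measurable_funX; exact: measurable_sumZ.
  - by move=> w _; rewrite lee_fin sqr_ge0.
  apply: (@le_trans _ _
    (((k.+1 ^ 2)%:R^-1 ^+ 2)%:E * (B ^+ 2 *+ (k.+1 ^ 2))%:E)%E).
    by rewrite lee_wpmul2l ?lee_fin ?sqr_ge0// integral_sqr_sum_le.
  have k0 : (k.+1 ^ 2)%:R != 0 :> R by rewrite pnatr_eq0 expn_eq0.
  rewrite -EFinM lee_fin -[B ^+ 2 *+ _]mulr_natr le_eqVlt; apply/orP; left.
  by apply/eqP; move: k0; set x := _%:R => x0; field.
(* Telescoping bound: with [x = n.+1], the slack [1/x - 1/(x+1) - 1/(x+1)^2] of the induction step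
   is [1/(x (x+1)^2)]. *)
have sumV n : \sum_(0 <= k < n.+1) ((k.+1 ^ 2)%:R^-1 : R) <= 2 - n.+1%:R^-1.
  elim: n => [|n ih]; first by rewrite big_nat1 exp1n invr1; lra.
  rewrite big_nat_recr//=; apply: le_trans (lerD ih (lexx _)) _.
  rewrite -addrA lerD2l -subr_ge0.
  have n1 : 0 < n.+1%:R :> R by [].
  rewrite natrX -(natr1 n.+1); set x := n.+1%:R in n1 *.
  rewrite [leRHS](_ : _ = (x * (x + 1) ^+ 2)^-1); last by field; lra.
  by rewrite invr_ge0 mulr_ge0 ?sqr_ge0// ltW.
(* A nonnegative series with finite expectation is finite almost surely, so its terms [V k w], the
   squared means along the squares, tend to 0. *)
have : (\int[P]_w (\sum_(k <oo) (V k w)%:E) < +oo)%E.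
  rewrite integral_nneseries//; last by move=> k w _; rewrite lee_fin.
  apply: (@le_lt_trans _ _ (B ^+ 2 * 2)%:E); last exact: ltry.
  apply: lime_le.
    apply: is_cvg_nneseries => k _ _.
    by apply: integral_ge0 => w _; rewrite lee_fin.
  near=> n.
  have n0 : (0 < n)%N by near: n; exists 1%N.
  apply: le_trans (lee_sum _ (fun k _ => intV k)) _.
  rewrite sumEFin lee_fin -mulr_sumr ler_wpM2l ?sqr_ge0//.
  by rewrite -(prednK n0) (le_trans (sumV _))// gerBl invr_ge0.
move=> intoo.
have iV : P.-integrable setT (fun w => \sum_(k <oo) (V k w)%:E)%E.
  apply/integrableP; split.
    by apply: ge0_emeasurable_sum => // k w _; rewrite lee_fin.
  rewrite (eq_integral (fun w => \sum_(k <oo) (V k w)%:E)%E)// => w _.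
  by rewrite gee0_abs//; apply: nneseries_ge0 => k _ _; rewrite lee_fin.
have := integrable_ae measurableT iV.
apply: filterS => w /(_ I) Vfin.
apply: (cvg_mean_squares _ _ _ (fun j => ZB j w)).
have /cvg_series_cvg_0 : cvgn (series (V ^~ w)).
  by apply: nnseries_is_cvg => //; rewrite ltey_eq Vfin.
move=> V_0; apply/cvgr0Pnorm_le => e e0.
have e2 : 0 < e ^+ 2 by rewrite exprn_gt0.
move/cvgr0Pnorm_le : V_0 => /(_ _ e2); apply: filterS => k.
rewrite ger0_norm// /V -[X in X <= _]real_normK ?num_real//.
by rewrite ler_pXn2r ?nnegrE// ltW.
Unshelve. all: by end_near. Qed.

End strong_law.

Section centering.
Context d (S : measurableType d) (R : realType) (P : probability S R).

(** The integral in the conclusion is the covariance of [X] and [Y], that is [E[XY] - a b];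
    boundedness supplies the integrability. *)
Lemma integral_centered_mul (X Y : S -> R) (B a b : R) :
  measurable_fun setT X -> measurable_fun setT Y ->
  (forall w, `|X w| <= B) -> (forall w, `|Y w| <= B) ->
  (\int[P]_w (X w)%:E = a%:E)%E -> (\int[P]_w (Y w)%:E = b%:E)%E ->
  (\int[P]_w (X w * Y w)%:E = (a * b)%:E)%E ->
  (\int[P]_w ((X w - a) * (Y w - b))%:E = 0)%E.
Proof.
move=> mX mY XB YB Xa Yb XYab.
have lX : X \in Lfun P 1.
  by apply/Lfun1_integrable; exact: probability_bounded_integrable XB.
have lY : Y \in Lfun P 1.
  by apply/Lfun1_integrable; exact: probability_bounded_integrable YB.
have lXY : X * Y \in Lfun P 1.
  apply/Lfun1_integrable.
  apply: (@probability_bounded_integrable _ _ _ _ _ (B * B)).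
    exact: measurable_funM.
  by move=> w; rewrite normrM ler_pM.
have := covarianceE lX lY lXY.
rewrite covariance.unlock expectation.unlock /= Xa Yb/= => ->.
by rewrite XYab subee.
Qed.

End centering.

(** * From averages to sums of logarithms *)

Lemma cvg_divn (R : realType) (c : R) : c / m%:R @[m --> \oo] --> (0 : R).
Proof.
rewrite -(mulr0 c); apply: cvgM; first exact: cvg_cst.
by rewrite -cvg_shiftS; exact: cvg_harmonic.
Qed.

Lemma cvg_sum_ln1Dx (R : realType) (x : nat -> R) (a B l : R) :
  0 <= a -> (forall j, 0 <= x j <= B) ->
  (\sum_(0 <= j < m) x j) / m%:R @[m --> \oo] --> l ->
  \sum_(0 <= j < m) ln (1 + a * x j / m%:R) @[m --> \oo] --> a * l.
Proof.
move=> a0 xB xl.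
pose s m := a * ((\sum_(0 <= j < m) x j) / m%:R).
have sE m : s m = \sum_(0 <= j < m) a * x j / m%:R.
  by rewrite /s mulrA mulr_sumr mulr_suml.
have sl : s m @[m --> \oo] --> a * l by apply: cvgM => //; exact: cvg_cst.
have t0 j m : 0 <= a * x j / m%:R.
  by have /andP[x0 _] := xB j; rewrite !mulr_ge0.
(* Each of the [m] logarithms falls below its linear term by at most [(a * B / m) ^ 2], so the total
   loss is at most [(a * B) ^ 2 / m]. *)
apply: (@squeeze_cvgr _ _ _ _
  (fun m => s m - (a * B) ^+ 2 / m%:R) s) => //; last first.
  by rewrite -[X in _ --> X]subr0; apply: cvgB => //; exact: cvg_divn.
near=> m; have m0 : (0 < m)%N by near: m; exists 1%N.
apply/andP; split; last first.
  rewrite sE; apply: ler_sum => j _; apply: le_ln1Dx.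
  exact: lt_le_trans (ltrN10 _) _.
rewrite sE lerBlDr -lerBlDl -sumrB.
apply: (@le_trans _ _ (\sum_(0 <= j < m) (a * B / m%:R) ^+ 2)).
  apply: ler_sum => j _.
  apply: (@le_trans _ _ ((a * x j / m%:R) ^+ 2)).
    by rewrite lerBlDr -lerBlDl; exact: sub_sqr_le_ln1Dx.
  have /andP[x0 xb] := xB j.
  by rewrite lerXn2r ?nnegrE// ?ler_wpM2r ?ler_wpM2l// !mulr_ge0// (le_trans x0).
rewrite sumr_const_nat subn0 -mulr_natr le_eqVlt; apply/orP; left; apply/eqP.
by field; rewrite pnatr_eq0 -lt0n.
Unshelve. all: by end_near. Qed.

(** * The strong law for bounded functions of independent points *)

Lemma mutually_independent_pair (d d' : measure_display) (T : measurableType d)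
    (R : realType) (P : probability T R) (U : measurableType d')
    (X : nat -> T -> U) (i j : nat) (A B : set U) :
  mutually_independent P X -> i != j -> measurable A -> measurable B ->
  (P (X i @^-1` A `&` X j @^-1` B) = P (X i @^-1` A) * P (X j @^-1` B))%E.
Proof.
move=> iX ij mA mB.
have ji : (j == i) = false by rewrite eq_sym (negbTE ij).
(* Since [i != j], the list has no repetition and the family takes the value [B] at [j]. *)
have := iX [:: i; j] (fun k => if k == i then A else B).
rewrite /= inE ij big_cons big_seq1 eqxx ji => <-//; last first.
  by move=> k _; case: ifP.
congr (P _); rewrite bigcap_seq !big_cons big_nil setIT eqxx ji.
by [].
Qed.

(** Independence factors the mixed moments, so the centred variables [g (X j w) - c] are pairwise
    uncorrelated; they are bounded by [B + |c|]. *)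
Lemma strong_law_independent (R : realType) (dS : measure_display)
    (S : measurableType dS) (P : probability S R) (d : measure_display)
    (U : measurableType d) (X : nat -> S -> U) (g : U -> R) (B c : R) :
  (forall j, measurable_fun setT (X j)) -> mutually_independent P X ->
  measurable_fun setT g -> (forall x, 0 <= g x <= B) ->
  (forall j, (\int[P]_w (g (X j w))%:E = c%:E)%E) ->
  {ae P, forall w, (\sum_(0 <= j < m) g (X j w)) / m%:R @[m --> \oo] --> c}.
Proof.
move=> mX iX mg gB gc.
have mgX j : measurable_fun setT (fun w => g (X j w)).
  exact: measurableT_comp.
have gX_le j w : `|g (X j w)| <= B.
  by have /andP[g0 gb] := gB (X j w); rewrite ger0_norm.
have Z_unc i j : i != j ->
  (\int[P]_w ((g (X i w) - c) * (g (X j w) - c))%:E = 0)%E.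
  move=> ij; apply: (integral_centered_mul _ _ _ _ _ _ B c c) => //.
  rewrite EFinM -{1}(gc i) -(gc j); under eq_integral do rewrite EFinM.
  pose Xi : {mfun S >-> U} :=
    HB.pack (X i) (isMeasurableFun.Build _ _ _ _ _ (mX i)).
  pose Xj : {mfun S >-> U} :=
    HB.pack (X j) (isMeasurableFun.Build _ _ _ _ _ (mX j)).
  apply: (ge0_integral_independent _ _ _ _ _ P Xi Xj (EFin \o g) (EFin \o g)).
  - by move=> A A' mA mA'; exact: mutually_independent_pair.
  - exact/measurable_EFinP.
  - exact/measurable_EFinP.
  - by move=> x; rewrite lee_fin; have /andP[] := gB x.
  - by move=> x; rewrite lee_fin; have /andP[] := gB x.
have mZ j : measurable_fun setT (fun w => g (X j w) - c).
  exact: measurable_funB.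
have Z_le j w : `|g (X j w) - c| <= B + `|c|.
  by rewrite (le_trans (ler_normB _ _))// lerD2r.
have := strong_law_uncorrelated _ _ _ P _ _ mZ Z_le Z_unc.
apply: filterS => w Zw.
have {}Zw : (\sum_(0 <= j < m) (g (X j w) - c)) / m%:R + c @[m --> \oo] --> c.
  by rewrite -[X in _ --> X]add0r; apply: cvgD => //; exact: cvg_cst.
(* The average of the constant [c] is [c] only for [m > 0]: at [m = 0] the quotient is 0. *)
apply: cvg_trans Zw; apply: near_eq_cvg; near=> m.
have m0 : (m%:R : R) != 0 by rewrite pnatr_eq0 -lt0n; near: m; exists 1%N.
by rewrite sumrB sumr_const_nat subn0 -[c *+ m]mulr_natr mulrBl mulfK// subrK.
Unshelve. all: by end_near. Qed.

(** For [m > 0] the added logarithms turn the expression into [a - ln (1 + c / m)] with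
    [c = n * expR a / q]. *)
Lemma cvg_ln_ratio (R : realType) (n : nat) (a q : R) :
  (0 < n)%N -> 0 < q ->
  ln ((n%:R * expR a) / (n%:R * expR a + m%:R * q)) + ln (m%:R / n%:R) + ln q
    @[m --> \oo] --> a.
Proof.
move=> n0 q0; have nR : 0 < n%:R :> R by rewrite ltr0n.
have ea := expR_gt0 a.
pose c := n%:R * expR a / q.
have c0 : 0 < c by rewrite divr_gt0// mulr_gt0.
have lim1 : a - ln (1 + c / m%:R) @[m --> \oo] --> a.
  rewrite -[X in _ --> X]subr0 -(@ln1 R) -[in X in _ --> X](addr0 1).
  apply: cvgB; first exact: cvg_cst.
  apply: continuous_cvg; first by apply: continuous_ln; rewrite addr0.
  by apply: cvgD; [exact: cvg_cst | exact: cvg_divn].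
apply: cvg_trans lim1; apply: near_eq_cvg; near=> m.
have m0 : 0 < m%:R :> R by rewrite ltr0n; near: m; exists 1%N.
have s0 : 0 < n%:R * expR a + m%:R * q by rewrite addr_gt0// mulr_gt0.
have -> : 1 + c / m%:R = (n%:R * expR a + m%:R * q) / (m%:R * q).
  by rewrite /c; field; rewrite !gt_eqF.
rewrite !ln_div ?posrE ?mulr_gt0// !lnM ?posrE// expRK.
by ring.
Unshelve. all: by end_near. Qed.

(** * Assembly of the data and reference limits *)

Theorem theorem3 (R : realType)
  (dO : measure_display) (Omega : measurableType dO)
  (mu : {measure set Omega -> \bar R})
  (q : Omega -> R)
  (hq_meas : measurable_fun setT q)
  (hq_pos : forall y, 0 < q y)
  (hq_int : (\int[mu]_x (q x)%:E = 1)%E)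
  (Theta : Type) (f : Theta -> Omega -> R) (theta : Theta)
  (hf_meas : measurable_fun setT (f theta))
  (C : R) (hC : forall y, f theta y - ln (q y) <= C)
  (nu : R) (n : nat) (y : 'I_n -> Omega)
  (dS : measure_display) (S : measurableType dS) (P : probability S R)
  (r : nat -> S -> Omega)
  (hr_meas : forall j, measurable_fun setT (r j))
  (hr_dens : forall j, has_density P mu q (r j))
  (hr_indep : mutually_independent P r) :
  {ae P, forall w : S,
    (fun m : nat => @Rm Omega R n m y (f theta) q nu (fun j => r j w)
        + n%:R * ln (m%:R / n%:R) + \sum_(i < n) ln (q (y i)))
      @ \oo --> Mobj mu y (f theta) nu}.
Proof.
pose ft := f theta.
(* Written as a single exponential, the ratio [expR (ft x + nu) / q x] is bounded directly through
   [hC]. *)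
pose g x := expR (ft x + nu - ln (q x)).
have gE x : g x = expR (ft x + nu) / q x by rewrite /g expRB lnK// posrE.
have gB x : 0 <= g x <= expR (C + nu).
  by rewrite expR_ge0 ler_expR addrAC lerD2r hC.
have g0 x : 0 <= g x by have /andP[] := gB x.
have mg : measurable_fun setT g.
  apply: measurableT_comp => //; apply: measurable_funB.
    exact: measurable_funD.
  exact: measurableT_comp.
pose l := Rintegral mu setT (fun x => expR (ft x + nu)).
have gl j : (\int[P]_w (g (r j w))%:E = l%:E)%E.
  pose rj : {mfun S >-> Omega} :=
    HB.pack (r j) (isMeasurableFun.Build _ _ _ _ _ (hr_meas j)).
  have gr_mu : (\int[P]_w (g (rj w))%:E = \int[mu]_x (expR (ft x + nu))%:E)%E.
    transitivity (\int[distribution P rj]_x (g x)%:E)%E.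
      by rewrite ge0_integral_distribution//; exact/measurable_EFinP.
    under [RHS]eq_integral => x _ do
      rewrite -(divfK (lt0r_neq0 (hq_pos x)) (expR _)) -gE EFinM.
    apply: ge0_integral_density => //.
    - by move=> x; exact: ltW.
    - by move=> A mA; exact: hr_dens.
    - exact/measurable_EFinP.
  (* [l] is the true value of the [mu]-integral only if that integral is finite; this is read off on
     the probability space, where [g] is bounded. *)
  rewrite gr_mu /l /Rintegral fineK// -gr_mu; apply: integrable_fin_num => //.
  apply: (probability_bounded_integrable _ _ _ _ _ (expR (C + nu))).
    exact: measurableT_comp.
  by move=> w; rewrite ger0_norm//; have /andP[] := gB (rj w).
have := strong_law_independent _ _ _ P _ _ r g (expR (C + nu)) l
  hr_meas hr_indep mg gB gl.
apply: filterS => w mean_l; rewrite /Mobj /Rm -/ft -/l.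
have data : \sum_(i < n) (ln ((n%:R * expR (ft (y i) + nu)) /
      (n%:R * expR (ft (y i) + nu) + m%:R * q (y i))) + ln (m%:R / n%:R)
      + ln (q (y i))) @[m --> \oo] --> \sum_(i < n) (ft (y i) + nu).
  apply: cvg_big => [|i _]; first exact: add_continuous.
  apply: cvg_ln_ratio => //.
  (* The index [i] itself shows that [n] is positive; for [n = 0] the data sum is empty. *)
  by case: (n) i => // -[].
have noise : \sum_(0 <= j < m) ln (1 + n%:R * g (r j w) / m%:R)
    @[m --> \oo] --> n%:R * l.
  exact: cvg_sum_ln1Dx _ (fun j => g (r j w)) n%:R _ l (ler0n _ _)
    (fun j => gB (r j w)) mean_l.
apply: cvg_trans (cvgB data noise); apply: near_eq_cvg; near=> m.
have m0 : 0 < m%:R :> R by rewrite ltr0n; near: m; exists 1%N.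
(* The correction [n * ln (m / n)] is one [ln (m / n)] per data point. The reference terms match
   because [m q / (n expR (ft + nu) + m q)] is the inverse of [1 + n g / m]. *)
rewrite !fctE !big_split/= sumr_const card_ord -[ln _ *+ n]mulr_natl.
rewrite big_mkord -sumrN [X in _ = X + _]addrAC [RHS]addrAC; congr (_ + _).
apply: eq_bigr => j _; rewrite -lnV ?posrE; last first.
  by rewrite ltr_wpDr// divr_ge0// mulr_ge0.
have qr := hq_pos (r j w); have er := expR_gt0 (ft (r j w) + nu).
have s0 : 0 < n%:R * expR (ft (r j w) + nu) + m%:R * q (r j w).
  by rewrite ltr_wpDl ?mulr_gt0// mulr_ge0// ltW.
by congr ln; rewrite gE; field; rewrite !gt_eqF.
Unshelve. all: by end_near. Qed.
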